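(* Let $N\ge 3$ be an integer. (i) Suppose $N=2M+1$. Up to multiplication by nonzero real constants, there exist exactly $M+1$ nonzero even vectors $\mathbf u\in\mathbb R^N$ satisfying $\ell(\mathbf u)+\ell(\mathcal F\mathbf u)=N+1$, and, up to multiplication by nonzero real constants, there exist exactly $M$ nonzero odd vectors $\mathbf v\in\mathbb R^N$ satisfying $\ell(\mathbf v)+\ell(\mathcal F\mathbf v)\le N+3$. (ii) Suppose $N=2M$. Up to multiplication by nonzero real constants, there exist exactly $M-1$ nonzero even vectors $\mathbf u\in\mathbb R^N$ satisfying $u(M)=(\mathcal F\mathbf u)(M)=0$ and $\ell(\mathbf u)+\ell(\mathcal F\mathbf u)\le N+2$, and, up to multiplication by nonzero real constants, there exist exactly $M-1$ nonzero odd vectors $\mathbf v\in\mathbb R^N$ satisfying $\ell(\mathbf v)+\ell(\mathcal F\mathbf v)\le N+2$.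
   Context: Vectors in $\mathbb C^N$ (and $\mathbb R^N$) are indexed by the set of integers $I_N=\{-M_0+1,-M_0+2,\dots,-M_0+N\}$, where $M_0=\lfloor (N+1)/2\rfloor$. (Thus $I_N=\{-M,\dots,M\}$ if $N=2M+1$, and $I_N=\{-M+1,\dots,M\}$ if $N=2M$.) The entry of $\mathbf u$ at index $k$ is written $u(k)$. The (centered) discrete Fourier transform $\mathcal F:\mathbb C^N\to\mathbb C^N$ is $$(\mathcal F\mathbf u)(j)=\frac1{\sqrt N}\sum_{k\in I_N}e^{-2\pi \mathrm i kj/N}u(k),\qquad j\in I_N.$$ A vector $\mathbf a\in\mathbb R^N$ is even (respectively odd) if $a(k)=a(j)$ (respectively $a(k)=-a(j)$) for all $k,j\in I_N$ with $k\equiv -j \pmod N$. For a nonzero vector $\mathbf b\in\mathbb C^N$, $\mathrm{supp}(\mathbf b)=\{k\in I_N: b(k)\ne 0\}$, and the (signal) length of $\mathbf b$ is $\ell(\mathbf b)=1+\max\{i-j : i,j\in\mathrm{supp}(\mathbf b)\}$. Counting ''up to multiplication by nonzero real constants'' means counting equivalence classes of vectors under the relation of being nonzero real multiples of each other. *)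

(* Defs.v *)
From mathcomp Require Import all_boot all_order all_algebra.
From mathcomp Require Import all_classical all_reals all_analysis.
From mathcomp Require Import complex zify.

Set Implicit Arguments.
Unset Strict Implicit.
Unset Printing Implicit Defensive.

Import Order.TTheory GRing.Theory Num.Theory.

Local Open Scope classical_set_scope.
Local Open Scope ring_scope.
Local Open Scope complex_scope.

(* Vectors are row vectors of length N; the ordinal position k : 'I_N (from 0)
   stands for the integer index idx k = -M0 + 1 + k, so that idx is the
   increasing bijection from 'I_N onto {-M0+1, ..., -M0+N} (see idx_inj,
   idx_bounds and idx_surj). *)
Definition M0 (N : nat) : nat := (N.+1 %/ 2)%N.

Definition idx (N : nat) (k : 'I_N) : int := - (M0 N)%:Z + 1 + (k : nat)%:Z.

Lemma idx_inj (N : nat) : injective (@idx N).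
Proof. by move=> i j; rewrite /idx => ij; apply/val_inj => /=; lia. Qed.

Lemma idx_bounds (N : nat) (k : 'I_N) :
  - (M0 N)%:Z + 1 <= idx k <= - (M0 N)%:Z + N%:Z.
Proof. by have := ltn_ord k; rewrite /idx; lia. Qed.

Lemma idx_surj (N : nat) (z : int) :
  - (M0 N)%:Z + 1 <= z <= - (M0 N)%:Z + N%:Z -> exists k : 'I_N, idx k = z.
Proof.
move=> zN.
have kN : (absz (z + (M0 N)%:Z - 1)%R < N)%N by lia.
by exists (Ordinal kN); rewrite /idx /=; lia.
Qed.

Definition expi (R : realType) (t : R) : R[i] := cos t +i* sin t.

Definition dft (R : realType) (N : nat) (u : 'rV[R[i]]_N) : 'rV[R[i]]_N :=
  \row_(j < N) (((Num.sqrt N%:R)^-1 : R)%:C *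
    \sum_(k < N) expi (- (2 * pi * (idx k)%:~R * (idx j)%:~R / N%:R)) * u 0 k).

Definition toC (R : realType) (N : nat) (u : 'rV[R]_N) : 'rV[R[i]]_N :=
  map_mx (fun x : R => x%:C) u.

Definition even_vec (R : realType) (N : nat) (a : 'rV[R]_N) : Prop :=
  forall k j : 'I_N, (idx k = - idx j %[mod N%:Z])%Z -> a 0 k = a 0 j.

Definition odd_vec (R : realType) (N : nat) (a : 'rV[R]_N) : Prop :=
  forall k j : 'I_N, (idx k = - idx j %[mod N%:Z])%Z -> a 0 k = - a 0 j.

Definition supp (V : nmodType) (N : nat) (b : 'rV[V]_N) : {set 'I_N} :=
  [set k | b 0 k != 0]%SET.

(* For b != 0 the pairs p with p.1 = p.2 in the support contribute 0, so the
   default value 0 does not affect the maximum. *)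
Definition ell (V : nmodType) (N : nat) (b : 'rV[V]_N) : int :=
  1 + \big[Order.max/0]_(p : 'I_N * 'I_N | (p.1 \in supp b) && (p.2 \in supp b))
        (idx p.1 - idx p.2).

Definition real_multiple (R : realType) (N : nat) (u v : 'rV[R]_N) : Prop :=
  exists2 c : R, c != 0 & v = c *: u.

Definition classes (R : realType) (N : nat) (P : set 'rV[R]_N) :
    set (set 'rV[R]_N) :=
  [set C | exists2 u, P u & C = [set v | real_multiple u v]].

Definition exactly_up_to_multiples (R : realType) (N : nat) (n : nat)
    (P : set 'rV[R]_N) : Prop :=
  (classes P #= `I_n)%card.

(* Main.v *)
Require Import Defs.
From mathcomp Require Import all_boot all_order all_algebra.
From mathcomp Require Import all_classical all_reals all_analysis.
From mathcomp Require Import complex zify ring lra.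

Set Implicit Arguments.
Unset Strict Implicit.
Unset Printing Implicit Defensive.

Import Order.TTheory GRing.Theory Num.Theory.

Local Open Scope classical_set_scope.
Local Open Scope ring_scope.
Local Open Scope complex_scope.

(** Fix a parity, [b = false] for even vectors and [b = true] for odd ones, and
    call radius of a vector the largest [|idx k|] over its support.  An even
    or odd vector whose support avoids the index [N / 2] has a symmetric
    support, so its length is one plus twice its radius.  On such vectors the
    transform is, up to a nonzero factor, the cosine (even) or sine (odd)
    transform [u *m trigmx b N], and all conditions of the theorem become
    conditions on [radius u + radius (u *m trigmx b N)].

    The heart of the matter is an uncertainty principle, [uncertainty]: with
    [m] the largest radius that the parity allows, a nonzero vector satisfies
    [m + b <= radius u + radius (u *m trigmx b N)].  Indeed Chebyshev
    polynomials write the transform at frequency [h] as [p.[cos (2 pi h / N)]]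
    (times a sine that does not vanish, in the odd case) where [p] has degree
    exactly [radius u - b]; every frequency between the radius of the transform
    and [m] yields a root of [p], and these roots are distinct.

    Everything else follows from this bound and linear algebra.
    - Existence of a vector attaining the bound with a prescribed radius [k]
      ([extremal_exists]): ask a vector of radius at most [k], that is
      [k - b + 1] unknowns, to have a transform vanishing at the last [k - b]
      frequencies.  A nonzero solution exists, and the bound forces both radii
      to be as large as allowed.
    - Uniqueness up to a scalar ([extremal_unique]): two extremal vectors of
      the same radius have a linear combination of smaller radius whose
      transform is not wider; by the bound, it is zero.
    So there is exactly one class of extremal vectors for each admissible
    radius, and in each of the four cases the inequality on lengths selects
    the extremal vectors; it remains to count radii.  For [N = 2 * M] and even
    vectors, vanishing at [M] together with the transform excludes the two
    extreme radii [M] and [0]. *)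

(** * Trigonometric functions of multiple angles as Chebyshev polynomials *)

Definition trig (R : realType) (b : bool) (t : R) : R :=
  if b then sin t else cos t.

(** The part of [trig b (h * t)] that is not a polynomial in [cos t]. *)
Definition trig_weight (R : realType) (b : bool) (t : R) : R :=
  if b then sin t else 1.

(** The factor relating the value of a [b]-parity function at [z] to its value
    at [|z|]; a vanishing sign at [0] matches odd functions vanishing there. *)
Definition psign (R : realType) (b : bool) (z : int) : R :=
  if b then (sgz z)%:~R else 1.

Lemma trig_absz (R : realType) (b : bool) (z : int) (t : R) :
  trig b (z%:~R * t) = psign R b z * trig b ((absz z)%:R * t).
Proof.
have zE : (z%:~R : R) = (sgz z)%:~R * (absz z)%:R.
  by rewrite {1}[z]intEsg intrM.
case: b => /=; rewrite zE; case: (sgzP z) => [z0|_|_];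
  rewrite ?mulN1r ?mulNr ?mul1r ?mul0r ?sin0 ?cos0 ?sinN ?cosN //.
by rewrite z0 mul0r cos0.
Qed.

Lemma trig_rec (R : realType) (b : bool) (h : nat) (t : R) :
  trig b (h.+2%:R * t) =
  2 * cos t * trig b (h.+1%:R * t) - trig b (h%:R * t).
Proof.
have -> : h.+2%:R * t = h.+1%:R * t + t by rewrite -[h.+2]addn1 natrD; ring.
have -> : h%:R * t = h.+1%:R * t - t by rewrite -[h.+1]addn1 natrD; ring.
by rewrite /trig; case: b; rewrite ?(sinD, cosD) ?sinN ?cosN; ring.
Qed.

(** Chebyshev polynomials of the first kind [T_h] for [b = false], and of the
    second kind [U_(h - 1)] for [b = true]: one recurrence, two initial values. *)
Fixpoint cheb (R : realType) (b : bool) (h : nat) : {poly R} :=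
  match h with
  | 0 => (~~ b)%:R
  | h'.+1 => match h' with
             | 0 => if b then 1 else 'X
             | h''.+1 => 2 *: ('X * cheb R b h') - cheb R b h''
             end
  end.

Lemma chebSS (R : realType) (b : bool) (h : nat) :
  cheb R b h.+2 = 2 *: ('X * cheb R b h.+1) - cheb R b h.
Proof. by []. Qed.

Lemma cheb_pair_ind (P : nat -> Prop) :
  P 0 -> P 1 -> (forall h, P h -> P h.+1 -> P h.+2) -> forall h, P h.
Proof.
move=> P0 P1 PS h; suff [] : P h /\ P h.+1 by [].
by elim: h => [|h [Ph PSh]]; split=> //; apply: PS.
Qed.

Lemma trig_cheb (R : realType) (b : bool) (h : nat) (t : R) :
  trig b (h%:R * t) = (cheb R b h).[cos t] * trig_weight b t.
Proof.
elim/cheb_pair_ind: h => [||h IH0 IH1].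
- by rewrite /trig /trig_weight mul0r /=;
    case: b; rewrite /= ?cos0 ?sin0 hornerC ?mul0r ?mulr1.
- by rewrite /trig /trig_weight mul1r /=;
    case: b; rewrite /= ?hornerC ?hornerX ?mul1r ?mulr1.
- by rewrite chebSS trig_rec IH0 IH1 hornerD hornerN hornerZ hornerM hornerX; ring.
Qed.

(** Degree [h - b]: dividing [sin (h t)] by [sin t] costs one degree, which is
    the origin of the term [b] in all later bounds.  For [h = 0] and [b = true]
    both sides are [0]. *)
Lemma size_cheb (R : realType) (b : bool) (h : nat) :
  size (cheb R b h) = (h.+1 - b)%N.
Proof.
elim/cheb_pair_ind: h => [||h IH0 IH1].
- by case: b; rewrite /= ?size_poly0 ?size_poly1.
- by case: b; rewrite /= ?size_polyX ?size_poly1.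
have nz : cheb R b h.+1 != 0 by rewrite -size_poly_eq0 IH1; case: (b).
have sz : size (2 *: ('X * cheb R b h.+1)) = (h.+3 - b)%N.
  rewrite size_scale ?pnatr_eq0 // mulrC size_mulX // IH1.
  by case: (b).
rewrite chebSS size_polyDl sz // size_polyN IH0.
by case: (b) => /=; lia.
Qed.

Lemma lead_cheb_neq0 (R : realType) (b : bool) (h : nat) :
  (b <= h)%N -> (cheb R b h)`_(h - b) != 0.
Proof.
move=> bh; have := size_cheb R b h.
have -> : (h.+1 - b = (h - b).+1)%N by lia.
by move=> sz; rewrite -[(h - b)%N]/((h - b).+1.-1) -sz lead_coef_eq0
  -size_poly_eq0 sz.
Qed.

(** * The frequencies and the real transforms *)

Definition angle (R : realType) (N h : nat) : R := 2 * pi * h%:R / N%:R.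

(** The real cosine and sine transforms, the two parts of the discrete Fourier
    transform before normalization. *)
Definition trigmx (R : realType) (b : bool) (N : nat) : 'M[R]_N :=
  \matrix_(k, j) trig b (2 * pi * (idx k)%:~R * (idx j)%:~R / N%:R).

(** Separates each entry into a polynomial in the cosine of the frequency, whose
    degree is governed by the row, and factors that depend on one index only. *)
Lemma trigmxE (R : realType) (b : bool) (N : nat) (k j : 'I_N) :
  trigmx R b N k j =
  psign R b (idx k) * (cheb R b (absz (idx k))).[cos (angle R N (absz (idx j)))]
  * (psign R b (idx j) * trig_weight b (angle R N (absz (idx j)))).
Proof.
rewrite mxE.
have -> : 2 * pi * (idx k)%:~R * (idx j)%:~R / N%:R =
          (idx k)%:~R * ((idx j)%:~R * (2 * pi / N%:R)) :> R by ring.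
rewrite trig_absz.
have -> : (absz (idx k))%:R * ((idx j)%:~R * (2 * pi / N%:R)) =
  (idx j)%:~R * ((absz (idx k))%:R * (2 * pi / N%:R)) :> R by ring.
rewrite trig_absz.
have -> : (absz (idx j))%:R * ((absz (idx k))%:R * (2 * pi / N%:R)) =
  (absz (idx k))%:R * angle R N (absz (idx j)) :> R by rewrite /angle; ring.
rewrite trig_cheb; ring.
Qed.

(** The largest radius met by vectors of parity [b]: [N / 2] for even ones, and
    [(N - 1) / 2] for odd ones, which vanish at the index [N / 2] since it is
    its own opposite modulo [N]. *)
Definition max_radius (b : bool) (N : nat) : nat := ((N - b) %/ 2)%N.

Lemma ord_of_radius (N h : nat) : (0 < N)%N -> (2 * h <= N)%N ->
  exists k : 'I_N, idx k = h%:Z.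
Proof. by move=> N0 hN; apply: idx_surj; rewrite /M0; lia. Qed.

Lemma angle_range (R : realType) (N h : nat) :
  (0 < N)%N -> (2 * h <= N)%N -> 0 <= angle R N h <= pi.
Proof.
move=> N0 hN; have pi0 := pi_ge0 R; rewrite /angle.
have N0' : (0 : R) < N%:R by rewrite ltr0n.
rewrite divr_ge0 ?mulr_ge0 ?ler0n //= ler_pdivrMr //.
rewrite mulrAC mulrC ler_wpM2l // -natrM ler_nat //.
Qed.

Lemma trig_weight_neq0 (R : realType) (b : bool) (N h : nat) :
  (0 < N)%N -> (b <= h <= max_radius b N)%N -> trig_weight b (angle R N h) != 0.
Proof.
case: b => //=; rewrite /trig_weight ?oner_eq0 // => N0 hb.
have h2 : (2 * h < N)%N by move: hb; rewrite /max_radius /=; lia.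
have h0 : (0 < h)%N by case/andP: hb.
have pi0 := pi_gt0 R.
apply/lt0r_neq0/sin_gt0_pi; rewrite /angle.
have N0' : (0 : R) < N%:R by rewrite ltr0n.
rewrite divr_gt0 ?mulr_gt0 ?ltr0n //= ltr_pdivrMr //.
by rewrite mulrAC mulrC ltr_pM2l // -natrM ltr_nat.
Qed.

(** The frequencies [0, ..., N / 2] have angles in [[0, pi]], where cosine is
    injective. *)
Lemma cos_angle_inj (R : realType) (N h h' : nat) :
  (0 < N)%N -> (2 * h <= N)%N -> (2 * h' <= N)%N ->
  cos (angle R N h) = cos (angle R N h') -> h = h'.
Proof.
move=> N0 hN hN' /cos_inj; rewrite !in_itv /= !angle_range // => /(_ isT isT).
have N0' : N%:R != 0 :> R by rewrite pnatr_eq0 -lt0n.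
have nz : (2 * pi : R) != 0.
  by rewrite mulf_neq0 ?pnatr_eq0 // lt0r_neq0 // pi_gt0.
move=> /(divIf N0') /(mulfI nz) /eqP.
by rewrite eqr_nat => /eqP.
Qed.

(** * Radius and parity *)

Definition radius (V : nmodType) (N : nat) (b : 'rV[V]_N) : nat :=
  (\max_(i in supp b) absz (idx i))%N.

Lemma le_radius (V : nmodType) (N : nat) (b : 'rV[V]_N) (i : 'I_N) :
  b 0 i != 0 -> (absz (idx i) <= radius b)%N.
Proof.
move=> bi; apply: (leq_bigmax_cond (F := fun i => absz (idx i))).
by rewrite inE.
Qed.

Lemma radius_lt_eq0 (V : nmodType) (N : nat) (b : 'rV[V]_N) (i : 'I_N) :
  (radius b < absz (idx i))%N -> b 0 i = 0.
Proof. by move=> h; apply/eqP; apply: contraLR h => /le_radius; rewrite -leqNgt. Qed.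

Lemma radius_le (V : nmodType) (N : nat) (b : 'rV[V]_N) (r : nat) :
  (forall i, (r < absz (idx i))%N -> b 0 i = 0) -> (radius b <= r)%N.
Proof.
move=> h; apply/bigmax_leqP => i; rewrite inE; apply: contraR.
by rewrite -ltnNge => /h ->.
Qed.

Lemma radius_witness (V : nmodType) (N : nat) (b : 'rV[V]_N) :
  b != 0 -> exists2 i, b 0 i != 0 & absz (idx i) = radius b.
Proof.
move=> b0; have sb0 : (0 < #|supp b|)%N.
  rewrite card_gt0; apply: contra b0 => /eqP sb.
  apply/eqP/rowP => i; rewrite mxE; apply/eqP.
  by have : i \notin supp b; [rewrite sb inE | rewrite inE negbK].
have [i bi e] := eq_bigmax_cond (fun i => absz (idx i)) sb0.
by exists i; [rewrite inE in bi | rewrite /radius e].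
Qed.

Lemma radius_scale (R : idomainType) (N : nat) (c : R) (u : 'rV[R]_N) :
  c != 0 -> radius (c *: u) = radius u.
Proof.
move=> c0; apply: eq_bigl => i.
by rewrite !inE mxE mulf_eq0 (negbTE c0).
Qed.

(** Evenness or oddness in a form that is uniform in [b] and mentions only
    [|idx i|] instead of congruences modulo [N]; [even_vecP] and [odd_vecP] give
    the equivalence.  The range condition carries, for odd vectors, the
    vanishing at the indices [0] and [N / 2] that are their own opposites. *)
Definition has_parity (R : realType) (b : bool) (N : nat) (u : 'rV[R]_N) :=
  (forall i j, absz (idx i) = absz (idx j) ->
     psign R b (idx i) * u 0 j = psign R b (idx j) * u 0 i) /\
  (forall i, u 0 i != 0 -> (b <= absz (idx i) <= max_radius b N)%N).

Lemma radius_bound (N : nat) (i : 'I_N) : (2 * absz (idx i) <= N)%N.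
Proof. by have := ltn_ord i; rewrite /idx /M0; lia. Qed.

Lemma psign_sqr (R : realType) (b : bool) (z : int) : (b <= absz z)%N ->
  psign R b z * psign R b z = 1.
Proof.
case: b => /=; rewrite /psign ?mulr1 //.
by case: (sgzP z) => [->//|_ _|_ _]; rewrite ?mulrNN ?mulr1.
Qed.

Lemma psign_neq0 (R : realType) (b : bool) (z : int) :
  (b <= absz z)%N -> psign R b z != 0.
Proof.
move=> /(psign_sqr R); apply: contra_eq_neq => ->.
by rewrite mul0r eq_sym oner_eq0.
Qed.

(** The even function underlying [u] is constant on indices of equal modulus. *)
Lemma psign_absz (R : realType) (b : bool) (N : nat) (i j : 'I_N) (u : 'rV[R]_N) :
  has_parity b u -> u 0 i != 0 -> absz (idx i) = absz (idx j) ->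
  psign R b (idx j) * u 0 j = psign R b (idx i) * u 0 i.
Proof.
move=> [up ur] ui0 ij; have /andP[bi _] := ur _ ui0.
have e := up _ _ ij.
have uj : u 0 j = psign R b (idx i) * (psign R b (idx j) * u 0 i).
  by rewrite -e mulrA psign_sqr // mul1r.
by rewrite uj mulrCA (mulrA (psign R b (idx j))) psign_sqr -?ij // mul1r.
Qed.

Lemma parity_lin (R : realType) (b : bool) (N : nat) (a c : R) (u v : 'rV[R]_N) :
  has_parity b u -> has_parity b v -> has_parity b (a *: u + c *: v).
Proof.
move=> [pu ru] [pv rv]; split=> [i j ij|i].
  rewrite !mxE !mulrDr !(mulrCA _ a) !(mulrCA _ c) (pu _ _ ij) (pv _ _ ij) //.
rewrite !mxE; have [u0|/ru //] := eqVneq (u 0 i) 0.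
rewrite u0 mulr0 add0r; have [v0|/rv //] := eqVneq (v 0 i) 0.
by rewrite v0 mulr0 eqxx.
Qed.

Lemma trig_weight_eq0 (R : realType) (b : bool) (N h : nat) : (2 * h <= N)%N ->
  (0 < N)%N -> ~~ (b <= h <= max_radius b N)%N -> trig_weight b (angle R N h) = 0.
Proof.
rewrite /max_radius; case: b => [h2 N0 hh|]; last by lia.
have : h = 0%N \/ (2 * h)%N = N by move: hh => /=; lia.
rewrite /trig_weight /angle => -[->|e]; first by rewrite mulr0 mul0r sin0.
have h0 : h%:R != 0 :> R by rewrite pnatr_eq0; lia.
suff -> : 2 * pi * h%:R / N%:R = pi :> R by rewrite sinpi.
by rewrite -e natrM; field.
Qed.

(** Both transforms produce vectors of their own parity from any vector; the
    range condition holds because sine vanishes at [0] and [pi]. *)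
Lemma parity_trigmx (R : realType) (b : bool) (N : nat) (u : 'rV[R]_N) :
  has_parity b (u *m trigmx R b N).
Proof.
split=> [i j ij|i].
  rewrite !mxE !big_distrr /=; apply: eq_bigr => k _.
  rewrite !trigmxE ij; ring.
apply: contraR => h; rewrite mxE; apply/eqP/big1 => k _.
rewrite trigmxE trig_weight_eq0 ?radius_bound ?mulr0 //.
by have := ltn_ord i; lia.
Qed.

(** * The uncertainty principle *)

Definition parity_poly (R : realType) (b : bool) (N : nat) (u : 'rV[R]_N) :=
  \sum_k (u 0 k * psign R b (idx k)) *: cheb R b (absz (idx k)).

Lemma trigmx_horner (R : realType) (b : bool) (N : nat) (u : 'rV[R]_N) j :
  (u *m trigmx R b N) 0 j =
  (parity_poly b u).[cos (angle R N (absz (idx j)))] *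
  (psign R b (idx j) * trig_weight b (angle R N (absz (idx j)))).
Proof.
rewrite mxE /parity_poly horner_sum big_distrl /=; apply: eq_bigr => k _.
by rewrite trigmxE hornerZ !mulrA.
Qed.

(** Only the indices of modulus [radius u] reach this degree.  By parity their
    contributions are all equal, so they add up instead of cancelling. *)
Lemma coef_parity_poly (R : realType) (b : bool) (N : nat) (u : 'rV[R]_N) :
  has_parity b u -> u != 0 -> (parity_poly b u)`_(radius u - b) != 0.
Proof.
move=> pu u0; have [i ui ir] := radius_witness u0.
have /andP[bi _] := pu.2 _ ui.
have -> : (parity_poly b u)`_(radius u - b) =
    \sum_(k : 'I_N | absz (idx k) == radius u)
      (psign R b (idx i) * u 0 i * (cheb R b (radius u))`_(radius u - b)).
  rewrite /parity_poly coef_sum [RHS]big_mkcond /=; apply: eq_bigr => k _.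
  (* Smaller moduli have too small a degree, larger ones a zero entry. *)
  rewrite coefZ; case: ltngtP => kr.
  - rewrite [X in _ * X]nth_default ?mulr0 // size_cheb; lia.
  - by rewrite radius_lt_eq0 ?mul0r // mul0r.
  - by rewrite kr [u 0 k * _]mulrC (psign_absz pu ui) ?ir ?kr.
rewrite sumr_const mulrn_eq0 negb_or; apply/andP; split.
  by rewrite -lt0n; apply/card_gt0P; exists i; rewrite unfold_in ir; apply: eqxx.
by rewrite !mulf_neq0 ?psign_neq0 ?lead_cheb_neq0 -?ir.
Qed.

Lemma size_parity_poly (R : realType) (b : bool) (N : nat) (u : 'rV[R]_N) :
  (size (parity_poly b u) <= (radius u).+1 - b)%N.
Proof.
apply: (leq_trans (size_sum _ _ _)); apply/bigmax_leqP => k _.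
have [->|/le_radius kr] := eqVneq (u 0 k) 0.
  by rewrite mul0r scale0r size_poly0.
by apply: (leq_trans (size_scale_leq _ _)); rewrite size_cheb; lia.
Qed.

(** The frequencies [h] beyond the radius of the transform, up to
    [max_radius b N], give distinct roots [cos (angle R N h)] of a nonzero
    polynomial of degree at most [radius u - b]. *)
Lemma uncertainty (R : realType) (b : bool) (N : nat) (u : 'rV[R]_N) :
  has_parity b u -> u != 0 ->
  (max_radius b N + b <= radius u + radius (u *m trigmx R b N))%N.
Proof.
move=> pu u0; set m := radius (u *m _).
have [i ui ir] := radius_witness u0; have /andP[bi _] := pu.2 _ ui.
have N0 : (0 < N)%N by have := ltn_ord i; lia.
have p0 : parity_poly b u != 0.
  by apply: contraTneq (coef_parity_poly pu u0) => ->; rewrite coef0 eqxx.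
pose rs := [seq cos (angle R N h) | h <- iota m.+1 (max_radius b N - m)].
have /max_poly_roots : all (root (parity_poly b u)) rs.
  apply/allP => x /mapP[h]; rewrite mem_iota => hm ->{x}.
  have h2 : (2 * h <= N)%N by move: hm; rewrite /max_radius; lia.
  have [j jh] := ord_of_radius N0 h2.
  have := @radius_lt_eq0 _ _ (u *m trigmx R b N) j.
  rewrite jh -/m => /(_ _)/eqP; rewrite trigmx_horner jh /=.
  have hb : (b <= h <= max_radius b N)%N by move: hm; case: (b); lia.
  have w0 := trig_weight_neq0 R N0 hb.
  have s0 : psign R b h != 0 by apply: psign_neq0; case/andP: hb.
  rewrite mulf_eq0 (negbTE (mulf_neq0 s0 w0)) orbF; apply; lia.
move=> /(_ p0).
have urs : uniq rs.
  rewrite map_inj_in_uniq ?iota_uniq // => h h'; rewrite !mem_iota => hm hm'.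
  by apply: cos_angle_inj => //; move: hm hm'; rewrite /max_radius; lia.
move=> /(_ urs); rewrite size_map size_iota.
have := size_parity_poly b u; rewrite -ir => sz /leq_trans /(_ sz).
by clear rs urs; move: bi; case: (b) => /=; lia.
Qed.

(** * Extremal vectors *)

Lemma wide_kernel (F : fieldType) (n : nat) (B : 'M[F]_(n.+1, n)) :
  exists2 c : 'rV_n.+1, c != 0 & c *m B = 0.
Proof.
have /rowV0Pn[c /sub_kermxP cB c0] : kermx B != 0; last by exists c.
rewrite kermx_eq0; apply/negP => /eqP rB.
by have := rank_leq_col B; rewrite rB ltnn.
Qed.

(** The combination [z] of [u] and [v] cancelling at one index of largest modulus
    cancels at all of them by parity.  Its radius is then too small for the
    uncertainty principle, unless it is zero. *)
Lemma extremal_unique (R : realType) (b : bool) (N : nat) (u v : 'rV[R]_N) :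
  has_parity b u -> u != 0 -> has_parity b v -> v != 0 ->
  (radius u + radius (u *m trigmx R b N) <= max_radius b N + b)%N ->
  (radius v + radius (v *m trigmx R b N) <= max_radius b N + b)%N ->
  radius u = radius v -> real_multiple u v.
Proof.
move=> pu u0 pv v0 eu ev uv.
have [i ui ir] := radius_witness u0; have [j vj jr] := radius_witness v0.
have ij : absz (idx i) = absz (idx j) by rewrite ir jr.
have /andP[bi _] := pu.2 _ ui.
have vi : v 0 i != 0.
  apply: contra_neq (mulf_neq0 (psign_neq0 R bi) vj) => vi.
  by rewrite (pv.1 _ _ ij) vi mulr0.
pose z := v 0 i *: u + (- u 0 i) *: v.
have pz : has_parity b z by apply: parity_lin.
have z0 : z = 0.
  apply/eqP/negPn/negP => zn0.
  have rz : (radius z < radius u)%N.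
    have [l zl lr] := radius_witness zn0; rewrite -lr ltnNge; apply: contra zl => ul.
    rewrite !mxE; apply/eqP; move: ul; rewrite leq_eqVlt => /orP[/eqP ul|ul].
      have il : absz (idx i) = absz (idx l) by rewrite ir ul.
      apply: (mulfI (psign_neq0 R bi)).
      transitivity (v 0 i * (psign R b (idx i) * u 0 l) -
                    u 0 i * (psign R b (idx i) * v 0 l)); first by ring.
      by rewrite (pu.1 _ _ il) (pv.1 _ _ il); ring.
    by rewrite (radius_lt_eq0 ul) (@radius_lt_eq0 _ _ v l) -?uv // !mulr0 addr0.
  have := uncertainty pz zn0.
  have : (radius (z *m trigmx R b N) <= max_radius b N + b - radius u)%N.
    apply: radius_le => l hl; rewrite mulmxDl -!scalemxAl mxE [X in X + _]mxE.
    rewrite [X in _ + X]mxE (@radius_lt_eq0 _ _ (u *m _)); last by lia.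
    by rewrite (@radius_lt_eq0 _ _ (v *m _)) ?mulr0 ?addr0 //; lia.
  by move: (radius (z *m _)) (radius z) (radius u) (max_radius b N) rz eu; lia.
exists (v 0 i / u 0 i); first by rewrite mulf_neq0 // invr_eq0.
apply: (scalerI ui); rewrite scalerA mulrCA mulfV // mulr1.
by apply/esym/eqP; rewrite -subr_eq0 -scaleNr -/z z0.
Qed.

(** One more unknown than equations gives a vector, and the uncertainty
    principle turns the upper bounds on the two radii into equalities. *)
Lemma extremal_exists (R : realType) (b : bool) (N k : nat) :
  (0 < N)%N -> (b <= k <= max_radius b N)%N ->
  exists u : 'rV[R]_N, [/\ has_parity b u, u != 0, radius u = k &
    radius (u *m trigmx R b N) = (max_radius b N + b - k)%N].
Proof.
move=> N0 /andP[bk kt]; pose m := (max_radius b N + b - k)%N; pose n := (k - b)%N.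
(* The rows of [E] are the vectors of parity [b] supported on one modulus among
   [b, ..., k]; [G] selects the frequencies [m + 1, ..., max_radius b N]. *)
pose E : 'M[R]_(n.+1, N) :=
  \matrix_(h, i) (psign R b (idx i) * (absz (idx i) == (h + b)%N)%:R).
pose G : 'M[R]_(N, n) := \matrix_(l, h) (idx l == (m.+1 + h)%N%:Z)%:R.
have [c c0 cB] := wide_kernel (E *m trigmx R b N *m G).
pose u := c *m E; exists u.
have uE i : u 0 i =
    psign R b (idx i) * \sum_h c 0 h * (absz (idx i) == (h + b)%N)%:R.
  by rewrite mxE big_distrr /=; apply: eq_bigr => h _; rewrite mxE mulrCA.
have ur i : u 0 i != 0 -> (b <= absz (idx i) <= k)%N.
  apply: contraR => hi; rewrite uE big1 ?mulr0 // => h _.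
  by case: eqP => [ih|_]; rewrite ?mulr0 //; have := ltn_ord h; lia.
have pu : has_parity b u.
  split=> [i j ij|i /ur]; last by lia.
  by rewrite !uE ij mulrCA.
have u0 : u != 0.
  have /rV0Pn[h ch] := c0.
  have hk : (2 * (h + b) <= N)%N.
    by have := ltn_ord h; move: kt; rewrite /max_radius; lia.
  have [i ih] := ord_of_radius N0 hk.
  apply/rV0Pn; exists i; rewrite uE ih mulf_neq0 ?psign_neq0 ?leq_addl //.
  rewrite (bigD1 h) //= eqxx mulr1 big1 ?addr0 // => l lh.
  by rewrite eqn_add2r eq_sym (inj_eq val_inj) (negbTE lh) mulr0.
have rm : (radius (u *m trigmx R b N) <= m)%N.
  apply: radius_le => j mj; have pA := @parity_trigmx R b N u.
  apply/eqP/negPn/negP => uj; have /andP[bj jt] := pA.2 _ uj.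
  (* [G] tests the frequency [|idx j|] only; parity transfers the zero to [j]. *)
  have j2 : (2 * absz (idx j) <= N)%N by apply: radius_bound.
  have [l lj] := ord_of_radius N0 j2.
  have hl : (absz (idx j) - m.+1 < n)%N by lia.
  have ul : (u *m trigmx R b N) 0 l = 0.
    have <- : (u *m trigmx R b N *m G) 0 (Ordinal hl) =
              (u *m trigmx R b N) 0 l.
      rewrite mxE (bigD1 l) //= [G l _]mxE lj /= subnKC // eqxx mulr1.
      rewrite big1 ?addr0 // => l' l'l; rewrite [G l' _]mxE /= subnKC // -lj.
      by rewrite (inj_eq (@idx_inj N)) (negbTE l'l) mulr0.
    by rewrite /u -!mulmxA mulmxA in cB *; rewrite cB mxE.
  have lj' : absz (idx l) = absz (idx j) by rewrite lj.
  have := pA.1 _ _ lj'; rewrite ul mulr0 => /eqP.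
  by rewrite mulf_eq0 (negbTE uj) orbF (negbTE (psign_neq0 R _)) // lj'.
have rk : (radius u <= k)%N.
  by apply: radius_le => i ki; apply/eqP/negPn/negP => /ur; lia.
have := uncertainty pu u0.
move: rk rm; rewrite /m => rk rm unc; split=> //;
  move: (radius u) (radius (_ *m _)) rk rm unc => r r'; lia.
Qed.

(** * The discrete Fourier transform of even and odd vectors *)

Lemma psignN (R : realType) (b : bool) (z : int) :
  psign R b (- z) = (-1) ^+ b * psign R b z.
Proof. by case: b; rewrite /psign ?mul1r // sgzN mulrNz expr1 mulN1r. Qed.

Lemma trigmx_opp (R : realType) (b : bool) (N : nat) (i k j : 'I_N) :
  idx k = - idx i -> trigmx R b N k j = (-1) ^+ b * trigmx R b N i j.
Proof.
move=> ki; rewrite !mxE ki mulrNz mulrN !mulNr.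
by rewrite /trig; case: (b); rewrite ?sinN ?cosN ?expr1 ?mulN1r ?mul1r.
Qed.

Lemma trigmx_sym (R : realType) (b : bool) (N : nat) (i j : 'I_N) :
  trigmx R b N i j = trigmx R b N j i.
Proof. by rewrite !mxE; congr (trig _ (_ / _)); ring. Qed.

Lemma parity_opp (R : realType) (b : bool) (N : nat) (u : 'rV[R]_N) (i k : 'I_N) :
  has_parity b u -> idx k = - idx i -> u 0 k = (-1) ^+ b * u 0 i.
Proof.
move=> pu ki; have [i0|i0] := eqVneq (idx i) 0.
  have -> : k = i by apply: (@idx_inj N); rewrite ki i0 oppr0.
  case: b pu => pu; last by rewrite mul1r.
  suff -> : u 0 i = 0 by rewrite mulr0.
  by apply/eqP/negPn/negP => /pu.2; rewrite i0.
have si : psign R b (idx i) != 0.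
  by apply: psign_neq0; move: i0; case: (b) => /=; lia.
apply: (mulfI si); have ik : absz (idx i) = absz (idx k) by rewrite ki abszN.
by rewrite (pu.1 _ _ ik) ki psignN; ring.
Qed.

(** Negation of indices is a permutation once the index [N / 2], which has no
    opposite in the range, is fixed; it changes the sign of the sum. *)
Lemma sum_odd_eq0 (V : zmodType) (N : nat) (g : 'I_N -> V) :
  (forall x : V, x = - x -> x = 0) ->
  (forall i k, idx k = - idx i -> g k = - g i) ->
  (forall i, (2 * absz (idx i))%N = N -> g i = 0) ->
  \sum_i g i = 0.
Proof.
move=> tf gN g2.
have pairing (i : 'I_N) : exists k : 'I_N,
    idx k = - idx i \/ idx k = idx i /\ (2 * absz (idx i))%N = N.
  have [e|ne] := eqVneq (2 * absz (idx i))%N N; first by exists i; right.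
  have := radius_bound i => ri.
  have [k ik] : exists k : 'I_N, idx k = - idx i.
    by apply: idx_surj; rewrite /M0; lia.
  by exists k; left.
have [f fP] := boolp.choice pairing.
have finj : injective f.
  move=> i i' ff; apply: (@idx_inj N).
  have bi := idx_bounds i; have bi' := idx_bounds i'; move: bi bi'.
  by move: (fP i) (fP i'); rewrite ff /M0; lia.
apply: tf; rewrite {1}(reindex_inj finj) /= -sumrN; apply: eq_bigr => i _.
by have [/gN //|[/idx_inj -> /g2 ->]] := fP i; rewrite oppr0.
Qed.

(** Even vectors have no sine part and odd vectors no cosine part, hence their
    Fourier transform vanishes exactly where the transform of their own parity
    does. *)
Lemma cross_trigmx (R : realType) (b : bool) (N : nat) (u : 'rV[R]_N) :
  has_parity b u -> u *m trigmx R (~~ b) N = 0.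
Proof.
move=> pu; apply/rowP => j; rewrite !mxE; apply: sum_odd_eq0.
- by move=> x xN; lra.
- move=> i k ki; rewrite (parity_opp pu ki) (trigmx_opp _ _ _ ki).
  by case: (b) => /=; ring.
- move=> i i2; case: b pu => pu /=.
    suff -> : u 0 i = 0 by rewrite mul0r.
    by apply/eqP/negPn/negP => /pu.2; rewrite /max_radius; lia.
  rewrite trigmx_sym trigmxE trig_weight_eq0 ?radius_bound ?mulr0 //.
    by have := ltn_ord i; lia.
  by rewrite /max_radius; lia.
Qed.

Lemma sum_complex (R : pzRingType) (I : finType) (x y : I -> R) :
  \sum_i (x i +i* y i) = (\sum_i x i) +i* (\sum_i y i).
Proof.
apply: (big_rec3 (fun z a c => z = a +i* c)) => // i z a c _ ->.
by [].
Qed.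

Lemma dft_toC (R : realType) (N : nat) (u : 'rV[R]_N) (j : 'I_N) :
  dft (toC u) 0 j = ((Num.sqrt N%:R)^-1 : R)%:C *
    ((u *m trigmx R false N) 0 j +i* - (u *m trigmx R true N) 0 j).
Proof.
rewrite mxE; congr (_ * _); rewrite !mxE -sumrN -sum_complex.
apply: eq_bigr => k _; rewrite !mxE /expi /trig cosN sinN.
by apply/eqP; rewrite eq_complex /=; apply/andP; split; apply/eqP; ring.
Qed.

Lemma dft_eq0 (R : realType) (b : bool) (N : nat) (u : 'rV[R]_N) (j : 'I_N) :
  has_parity b u -> (dft (toC u) 0 j == 0) = ((u *m trigmx R b N) 0 j == 0).
Proof.
move=> pu; rewrite dft_toC mulf_eq0.
have s0 : (Num.sqrt N%:R : R)^-1 != 0.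
  by rewrite invr_eq0 sqrtr_eq0 -ltNge ltr0n; have := ltn_ord j; lia.
rewrite [_%:C == 0]eq_complex /= (negbTE s0) /= eq_complex /=.
have /rowP/(_ j) := cross_trigmx pu; rewrite [in RHS]mxE.
by case: (b) => /= ->; rewrite ?oppr0 ?oppr_eq0 eqxx ?andbT.
Qed.

(** * Lengths in terms of radii *)

(** The two indices of largest modulus realize the length.  For [b = 0] both
    sides are [1], by the convention on empty maxima. *)
Lemma ell_symmetric (V : nmodType) (N : nat) (b : 'rV[V]_N) :
  (forall i, b 0 i != 0 -> exists2 j, idx j = - idx i & b 0 j != 0) ->
  ell b = 1 + 2 * (radius b)%:Z.
Proof.
move=> bs; rewrite /ell; congr (_ + _); apply/eqP; rewrite eq_le.
apply/andP; split.
  apply: bigmax_le => [|[i j] /=]; first by lia.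
  by rewrite !inE => /andP[/le_radius bi /le_radius bj]; lia.
have [b0|/radius_witness[i bi <-]] := eqVneq b 0.
  suff -> : radius b = 0%N by apply: bigmax_ge_id.
  by apply/eqP; rewrite -leqn0; apply: radius_le => i _; rewrite b0 mxE.
have [j ji bj] := bs _ bi.
pose S (p : 'I_N * 'I_N) := (p.1 \in supp b) && (p.2 \in supp b).
have [i0|i0] := leP 0 (idx i).
  have := @le_bigmax_cond _ _ _ 0 (i, j) S (fun p => idx p.1 - idx p.2).
  by rewrite /S !inE bi bj => /(_ isT); apply: le_trans; rewrite /= ji; lia.
have := @le_bigmax_cond _ _ _ 0 (j, i) S (fun p => idx p.1 - idx p.2).
by rewrite /S !inE bi bj => /(_ isT); apply: le_trans; rewrite /= ji; lia.
Qed.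

Lemma ell_parity (R : realType) (b : bool) (N : nat) (u : 'rV[R]_N) :
  has_parity b u -> (2 * radius u < N)%N -> ell u = 1 + 2 * (radius u)%:Z.
Proof.
move=> pu rN; apply: ell_symmetric => i ui.
have [j ji] : exists j : 'I_N, idx j = - idx i.
  by apply: idx_surj; have := le_radius ui; rewrite /M0; lia.
by exists j => //; rewrite (parity_opp pu ji) mulf_neq0 // signr_eq0.
Qed.

Lemma ell_dft (R : realType) (b : bool) (N : nat) (u : 'rV[R]_N) :
  has_parity b u -> (2 * radius (u *m trigmx R b N) < N)%N ->
  ell (dft (toC u)) = 1 + 2 * (radius (u *m trigmx R b N))%:Z.
Proof.
move=> pu rN; rewrite -(ell_parity (@parity_trigmx R b N u) rN) /ell.
by congr (_ + _); apply: eq_bigl => p; rewrite !inE !(dft_eq0 _ pu).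
Qed.

Lemma odd_radius_lt (R : realType) (N : nat) (u : 'rV[R]_N) : (0 < N)%N ->
  has_parity true u -> (2 * radius u < N)%N.
Proof.
move=> N0 pu; have [->|/radius_witness[i /pu.2 + <-]] := eqVneq u 0.
  suff -> : radius (0 : 'rV[R]_N) = 0%N by lia.
  by apply/eqP; rewrite -leqn0; apply: radius_le => i _; rewrite mxE.
by rewrite /max_radius; lia.
Qed.

Lemma radius_le_half (V : nmodType) (N : nat) (b : 'rV[V]_N) : (2 * radius b <= N)%N.
Proof.
suff : (radius b <= N %/ 2)%N by lia.
by apply: radius_le => i; have := radius_bound i; lia.
Qed.

(** * Parity modulo N *)

(** Sums of two indices lie strictly above [- N] and at most at [N], so a
    congruence is an equality except at the index [N / 2]. *)
Lemma idx_modN (N : nat) (k j : 'I_N) :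
  (idx k = - idx j %[mod N%:Z])%Z <->
  idx k = - idx j \/ k = j /\ (2 * absz (idx k))%N = N.
Proof.
have bk := radius_bound k; have bj := radius_bound j.
have N0 := ltn_ord k.
split=> [/eqP|[-> //|[-> e]]].
  rewrite eqz_mod_dvd opprK => /dvdzP[q e].
  have [q0|q0] := eqVneq q 0; first by left; move: e; rewrite q0; lia.
  have q1 : (q = 1 \/ q = -1)%R by nia.
  have kb := idx_bounds k; have jb := idx_bounds j; rewrite /M0 in kb jb.
  right; case: q1 e => ->; rewrite ?mul1r ?mulN1r => e; last by lia.
  by split; [apply: (@idx_inj N) | idtac]; lia.
apply/eqP; rewrite eqz_mod_dvd opprK; apply/dvdzP.
have [i0|i0] := leP 0 (idx j); [exists 1 | exists (-1)]; lia.
Qed.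

Lemma absz_idx_eq (N : nat) (i j : 'I_N) :
  absz (idx i) = absz (idx j) -> i = j \/ idx i = - idx j.
Proof.
move=> e; have [|] : idx i = idx j \/ idx i = - idx j by lia.
- by move=> /idx_inj; left.
- by right.
Qed.

Lemma even_vecP (R : realType) (N : nat) (u : 'rV[R]_N) :
  even_vec u <-> has_parity false u.
Proof.
split=> [eu|pu k j /idx_modN kj].
  split=> [i j /absz_idx_eq[->//|ij]|i _].
    by rewrite !mul1r (eu i j) // ij.
  by have := radius_bound i; rewrite /max_radius; lia.
have kj' : absz (idx k) = absz (idx j) by case: kj => [->|[-> //]]; rewrite abszN.
by have := pu.1 _ _ kj'; rewrite !mul1r.
Qed.

Lemma odd_vecP (R : realType) (N : nat) (u : 'rV[R]_N) :
  odd_vec u <-> has_parity true u.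
Proof.
split=> [ou|pu k j /idx_modN[kj|[-> e]]].
- split=> [i j /absz_idx_eq[->//|ij]|i ui].
    by rewrite (ou i j) ij // psignN expr1; ring.
  have := radius_bound i; rewrite leq_eqVlt => /orP[/eqP e|]; last first.
    have [i0|] := eqVneq (idx i) 0; last by rewrite /max_radius; lia.
    have := ou i i; rewrite i0 oppr0 => /(_ erefl) uN.
    by case/eqP: ui; lra.
  have /ou uN : (idx i = - idx i %[mod N%:Z])%Z by apply/idx_modN; right.
  by case/eqP: ui; lra.
- by rewrite (parity_opp pu kj) expr1 mulN1r.
- suff -> : u 0 j = 0 by rewrite oppr0.
  by apply/eqP/negPn/negP => /pu.2; rewrite /max_radius; lia.
Qed.

(** * Counting classes by their radius *)

(** The radius is invariant under nonzero scalars, hence labels the classes. *)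
Lemma exactly_by_radius (R : realType) (N lo n : nat) (P : set 'rV[R]_N) :
  (forall u, P u -> (lo <= radius u < lo + n)%N) ->
  (forall h, (lo <= h < lo + n)%N -> exists2 u, P u & radius u = h) ->
  (forall u v, P u -> P v -> radius u = radius v -> real_multiple u v) ->
  exactly_up_to_multiples n P.
Proof.
move=> Pr Pex Puniq.
have pick_radius (i : nat) : exists u : 'rV[R]_N,
    (i < n)%N -> P u /\ radius u = (lo + i)%N.
  have [ni|ni] := leqP n i; first by exists 0.
  by have [|u Pu ur] := Pex (lo + i)%N; [lia | exists u].
have [w wP] := boolp.choice pick_radius.
pose cl (u : 'rV[R]_N) := [set v | real_multiple u v].
have clP u v : P u -> P v -> radius u = radius v -> cl u = cl v.
  move=> Pu Pv uv; apply/seteqP; split=> z [c c0 ->].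
    have [d d0 ->] := Puniq _ _ Pv Pu (esym uv).
    by exists (c * d); [rewrite mulf_neq0 | rewrite scalerA].
  have [d d0 ->] := Puniq _ _ Pu Pv uv.
  by exists (c * d); [rewrite mulf_neq0 | rewrite scalerA].
rewrite /exactly_up_to_multiples.
have -> : classes P = (cl \o w) @` `I_n.
  apply/seteqP; split=> [C [u Pu ->]|C [i /= ni <-]]; last first.
    by exists (w i) => //; case: (wP i ni).
  have ur := Pr _ Pu; have ni : (radius u - lo < n)%N by lia.
  exists (radius u - lo)%N => //=; have [Pw wr] := wP _ ni.
  by apply: clP => //; rewrite wr; lia.
apply: inj_card_eq => i j; rewrite !inE /= => ni nj ij.
have : cl (w i) (w j) by rewrite ij; exists 1; rewrite ?oner_eq0 // scale1r.
move=> [c c0 wj]; have := radius_scale (w i) c0.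
by rewrite -wj (wP i ni).2 (wP j nj).2 => /addnI.
Qed.

(** For extremal vectors the uncertainty principle makes the sum of the two radii
    minimal, so an equality describes them. *)
Lemma exactly_extremal (R : realType) (b : bool) (N lo n : nat) (P : set 'rV[R]_N) :
  (0 < N)%N -> (b <= lo)%N -> (lo + n <= (max_radius b N).+1)%N ->
  (forall u, P u <-> [/\ has_parity b u, u != 0,
      (radius u + radius (u *m trigmx R b N) = max_radius b N + b)%N &
      (lo <= radius u < lo + n)%N]) ->
  exactly_up_to_multiples n P.
Proof.
move=> N0 blo lon PE; apply: (@exactly_by_radius R N lo).
- by move=> u /PE[].
- move=> h hn; have [|u [pu u0 ur uA]] := @extremal_exists R b N h N0; first by lia.
  exists u => //; apply/PE; split=> //; first by rewrite ur uA; lia.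
  by rewrite ur.
- move=> u v /PE[pu u0 eu _] /PE[pv v0 ev _] uv.
  by apply: (extremal_unique pu u0 pv v0); rewrite ?eu ?ev.
Qed.

Local Close Scope complex_scope.

Theorem theorem1 (R : realType) (N M : nat) (hN : (3 <= N)%N) :
  (N = (2 * M + 1)%N ->
     exactly_up_to_multiples (M + 1)%N
       [set u : 'rV[R]_N | [/\ u != 0, even_vec u &
          ell u + ell (dft (toC u)) = N%:Z + 1]] /\
     exactly_up_to_multiples M
       [set v : 'rV[R]_N | [/\ v != 0, odd_vec v &
          ell v + ell (dft (toC v)) <= N%:Z + 3]]) /\
  (N = (2 * M)%N ->
     exactly_up_to_multiples (M - 1)%N
       [set u : 'rV[R]_N | [/\ u != 0, even_vec u,
          (forall k : 'I_N, idx k = M%:Z ->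
             u 0 k = 0 /\ dft (toC u) 0 k = 0) &
          ell u + ell (dft (toC u)) <= N%:Z + 2]] /\
     exactly_up_to_multiples (M - 1)%N
       [set v : 'rV[R]_N | [/\ v != 0, odd_vec v &
          ell v + ell (dft (toC v)) <= N%:Z + 2]]).
Proof.
have N0 : (0 < N)%N by lia.
have oddP (v : 'rV[R]_N) : has_parity true v -> ell v + ell (dft (toC v)) =
    2 * (radius v)%:Z + 2 * (radius (v *m trigmx R true N))%:Z + 2.
  move=> pv; rewrite (ell_parity pv) ?(ell_dft pv) ?odd_radius_lt //; first by ring.
  exact: parity_trigmx.
split=> NE; split.
(* All radii [0, ..., M]. *)
- apply: (@exactly_extremal R false N 0) => //; first by rewrite /max_radius; lia.
  move=> u; have tE : max_radius false N = M by rewrite /max_radius; lia.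
  have h1 := radius_le_half u; have h2 := radius_le_half (u *m trigmx R false N).
  rewrite tE; split=> [[u0 /even_vecP pu]|[pu u0 e _]].
    rewrite (ell_parity pu) ?(ell_dft pu); [|lia|lia].
    by move=> e; split=> //; lia.
  split=> //; first exact/even_vecP.
  by rewrite (ell_parity pu) ?(ell_dft pu); lia.
- apply: (@exactly_extremal R true N 1) => //; first by rewrite /max_radius; lia.
  move=> u; have tE : max_radius true N = M by rewrite /max_radius; lia.
  rewrite tE; split=> [[u0 /odd_vecP pu]|[pu u0 e _]].
    rewrite oddP // => e; have := uncertainty pu u0; rewrite tE => unc.
    have [i /pu.2 + ir] := radius_witness u0; rewrite ir tE => ri.
    by split=> //; lia.
  split=> //; first exact/odd_vecP.
  by rewrite oddP //; lia.
(* Vanishing at [M] keeps both radii below [M], that is, as they add up to [M],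
   strictly between [0] and [M]. *)
- apply: (@exactly_extremal R false N 1) => //; first by rewrite /max_radius; lia.
  move=> u; have tE : max_radius false N = M by rewrite /max_radius; lia.
  have h1 := radius_le_half u; have h2 := radius_le_half (u *m trigmx R false N).
  have [kM kME] : exists k : 'I_N, idx k = M%:Z by apply: ord_of_radius; lia.
  have atM (k : 'I_N) : (2 * absz (idx k))%N = N -> k = kM.
    move=> kM2; apply: (@idx_inj N); have := idx_bounds k.
    by rewrite kME /M0; lia.
  rewrite tE; split=> [[u0 /even_vecP pu uM]|[pu u0 e ru]].
    have [uM0 /eqP] := uM _ kME; rewrite (dft_eq0 _ pu) => /eqP AM0.
    have lt (w : 'rV[R]_N) : w 0 kM = 0 -> (radius w < M)%N.
      move=> w0; have : (radius w <= M.-1)%N; last by lia.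
      apply: radius_le => i iM; rewrite (atM i) //.
      by have := radius_bound i; lia.
    have l1 : (radius u < M)%N by exact: lt.
    have l2 : (radius (u *m trigmx R false N) < M)%N by exact: lt.
    rewrite (ell_parity pu) ?(ell_dft pu); [|lia|lia].
    move=> e; have := uncertainty pu u0; rewrite tE => unc.
    by split=> //; lia.
  split=> //; first exact/even_vecP.
    move=> k kM'; split; first by apply: radius_lt_eq0; rewrite kM' /=; lia.
    by apply/eqP; rewrite (dft_eq0 _ pu); apply/eqP/radius_lt_eq0;
      rewrite kM' /=; lia.
  by rewrite (ell_parity pu) ?(ell_dft pu); lia.
- apply: (@exactly_extremal R true N 1) => //; first by rewrite /max_radius; lia.
  move=> u; have tE : max_radius true N = (M - 1)%N by rewrite /max_radius; lia.
  rewrite tE; split=> [[u0 /odd_vecP pu]|[pu u0 e _]].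
    rewrite oddP // => e; have := uncertainty pu u0; rewrite tE => unc.
    have [i /pu.2 + ir] := radius_witness u0; rewrite ir tE => ri.
    by split=> //; lia.
  split=> //; first exact/odd_vecP.
  by rewrite oddP //; lia.
Qed.
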